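(* There are no separable universal objects for the categories of separable complex Banach algebras, in either the commutative or the general setting, for contractive or merely bounded homomorphic embeddings. More precisely: (A) there is no separable commutative Banach algebra $B$ such that for every separable commutative Banach algebra $A$ there exists a contractive homomorphic embedding $A\hookrightarrow B$; (B) there is no separable commutative Banach algebra $B$ such that for every separable commutative Banach algebra $A$ there exists a bounded homomorphic embedding $A\hookrightarrow B$; (C) there is no separable Banach algebra $B$ such that for every separable Banach algebra $A$ there exists a contractive homomorphic embedding $A\hookrightarrow B$; (D) there is no separable Banach algebra $B$ such that for every separable Banach algebra $A$ there exists a bounded homomorphic embedding $A\hookrightarrow B$.
   Context: All Banach algebras are over $\mathbb{C}$: a Banach algebra is an associative $\mathbb{C}$-algebra that is a Banach space with a submultiplicative norm, $\lVert ab\rVert\leqslant\lVert a\rVert\,\lVert b\rVert$. Banach algebras are not assumed unital. A homomorphism is a $\mathbb{C}$-linear multiplicative map; homomorphisms are not assumed unital. A (homomorphic) embedding $A\hookrightarrow B$ is an injective homomorphism that is a topological isomorphism onto its range, the range being closed in $B$. It is contractive if its operator norm is at most $1$, and bounded if its operator norm is finite. Separable means separable as a metric space in the norm. *)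

(* Defs.v *)
From HB Require Import structures.
From mathcomp Require Import all_boot all_order all_algebra.
From mathcomp Require Import complex.
From mathcomp Require Import all_classical all_reals all_analysis.

Set Implicit Arguments.
Unset Strict Implicit.
Unset Printing Implicit Defensive.

Import Order.TTheory GRing.Theory Num.Theory.
Import numFieldNormedType.Exports.

Local Open Scope classical_set_scope.
Local Open Scope ring_scope.
Local Open Scope complex_scope.

(* MathComp rings are unital, so the multiplication of a not necessarily unital
   algebra is a separate operation [bmul] rather than that of a ring instance. *)
HB.mixin Record isBanachAlgebra (K : numFieldType) A
    & CompleteNormedModule K A := {
  bmul : A -> A -> A;
  bmulA : associative bmul;
  bmulDl : left_distributive bmul +%R;
  bmulDr : right_distributive bmul +%R;
  bmulZl : forall (k : K) (a b : A), bmul (k *: a) b = k *: bmul a b;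
  bmulZr : forall (k : K) (a b : A), bmul a (k *: b) = k *: bmul a b;
  ler_norm_bmul : forall a b : A, `|bmul a b| <= `|a| * `|b|
}.

#[short(type="banachAlgType")]
HB.structure Definition BanachAlgebra (K : numFieldType) :=
  {A of isBanachAlgebra K A & CompleteNormedModule K A}.

Definition bcommutative (K : numFieldType) (A : banachAlgType K) : Prop :=
  commutative (@bmul K A).

Definition separable (T : topologicalType) : Prop :=
  exists2 D : set T, countable D & dense D.

Definition homeo_onto_range (S T : topologicalType) (f : S -> T) : Prop :=
  continuous f /\
  exists2 g : T -> S, cancel f g & {within range f, continuous g}.

Definition bmultiplicative (K : numFieldType) (A B : banachAlgType K)
    (f : A -> B) : Prop :=
  forall a b : A, f (bmul a b) = bmul (f a) (f b).

Definition hom_embedding (K : numFieldType) (A B : banachAlgType K)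
    (f : {linear A -> B}) : Prop :=
  [/\ bmultiplicative f, injective f, homeo_onto_range f & closed (range f)].

(* The norm of a space over [R[i]] takes values in [R[i]], where it is a
   nonnegative real; [complex.Re] brings it back to [R] without loss. *)
Definition opnorm (R : realType) (V W : normedModType R[i])
    (f : {linear V -> W}) : \bar R :=
  ereal_sup [set (complex.Re `|f x|)%:E | x in [set x : V | `|x| <= 1]].

Definition contractive (R : realType) (V W : normedModType R[i])
    (f : {linear V -> W}) : Prop := (opnorm f <= 1)%E.

Definition bounded_op (R : realType) (V W : normedModType R[i])
    (f : {linear V -> W}) : Prop := (opnorm f < +oo)%E.

(* Main.v *)
Require Import Defs.
From HB Require Import structures.
From mathcomp Require Import all_boot all_order all_algebra.
From mathcomp Require Import complex.
From mathcomp Require Import all_classical all_reals all_analysis.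
From mathcomp Require Import ring lra zify.
Import Order.TTheory GRing.Theory Num.Theory.
Import numFieldNormedType.Exports.
Local Open Scope ring_scope.
Local Open Scope complex_scope.
Set Implicit Arguments.
Unset Strict Implicit.
Unset Printing Implicit Defensive.

(** The obstruction is a family of commutative separable algebras [alg R s],
    indexed by sequences of bits [s], such that no separable Banach algebra,
    commutative or not, contains all of them; this settles the four cases at
    once.  It rests on the failure of the approximation property, in the way
    of Johnson and Szankowski's theorem that no separable Banach space is
    complementably universal.

    Each [alg R s] is nilpotent: it is spanned by a space [X] of functions, a
    space [Y] of functionals on [X], and one vector [omega], with
    [x * y = <x, y> omega] and all other products zero.  Inside, there are
    finite levels [x_i, y_i], for [i] in [words n], with [x_i * y_i = omega].
    So if [f] embeds [alg R s], then [f omega] is the mean of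
    [f x_i * f y_i] over the level [m], for any [m].  Take a second embedding
    [f'] of [alg R s'], and replace [f y_i] by [f' y_i]: this gives the
    elements [mixed m].  Three facts lead to a contradiction.

    - If [f y_i] and [f' y_i] are close on the finite level [m], then
      [mixed m] is close to [f omega] ([mixed_close]).  In a separable target,
      a countable amount of information on [s] ensures this closeness, and
      two different sequences must share it ([cantor_collision]).
    - [mixed n - mixed n.+1] is small, with a convergent sum over [n]
      ([mixed_step]).  Block [n] of points joins the levels [n] and [n.+1]: on
      it the [x_i] are signs, and [y_i] is the mean of [x_i h] times the
      evaluation at [h] over the points [h] of block [n], but also of block
      [n.-1].  So this difference is a mean over [h] of [f z_h * f' del_h],
      where the evaluations [del_h] have norm at most 1, and [z_h] is a
      difference of means of [x_i] with signs.  Its sup norm only involves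
      correlations of sign vectors, and these are tiny ([zdiff]).
    - The bit [s n] selects the sign vectors of block [n].  If [s n] and
      [s' n] differ, the vectors are uncorrelated, and [mixed n] itself is
      small ([mixed_last]).

    As the levels up to [n] are joined by differences of small total norm,
    [mixed m] is small, hence so is [f omega], whereas injectivity of [f] bounds
    it below.  All products have their factor from the image of [f] on the left,
    so the target may be noncommutative.

    The sign vectors come from the quadratic phases
    [(-1)^(c v1 v2 + l1 v1 + l2 v2)] on the plane over the field with two
    elements: for one [c] they are orthogonal as [l] varies, and for two
    values of [c] all inner products have half the maximal absolute value.  Products of [n]
    such phases, with a code [c] that distinguishes labels in one coordinate
    out of five, have correlations at most [2 ^ - (n %/ 5)]. *)

(** * Norms over the complex numbers as real numbers *)

Section RealNorm.
Variables (R : realType) (V : normedModType R[i]).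
Implicit Types x y : V.

(** The norm takes values in [R[i]], which is only partially ordered; estimates
    are carried out in [R]. *)
Definition nr x : R := complex.Re `|x|.

Lemma nrE x : `|x| = (nr x)%:C.
Proof. by rewrite /nr RRe_real// ger0_real. Qed.

Lemma nr_ge0 x : 0 <= nr x.
Proof. by rewrite -lecR -nrE; exact: normr_ge0. Qed.

Lemma nr_le x (M : R) : (nr x <= M) = (`|x| <= M%:C).
Proof. by rewrite nrE lecR. Qed.

Lemma nr_lt x (M : R) : (nr x < M) = (`|x| < M%:C).
Proof. by rewrite nrE ltcR. Qed.

Lemma nr0 : nr (0 : V) = 0.
Proof. by rewrite /nr normr0. Qed.

Lemma nr_eq0 x : nr x = 0 -> x = 0.
Proof. by move=> h; apply/normr0_eq0; rewrite nrE h. Qed.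

Lemma nrN x : nr (- x) = nr x.
Proof. by rewrite /nr normrN. Qed.

Lemma nrC x y : nr (x - y) = nr (y - x).
Proof. by rewrite /nr distrC. Qed.

Lemma nrD x y : nr (x + y) <= nr x + nr y.
Proof. by rewrite nr_le rmorphD/= -!nrE ler_normD. Qed.

Lemma nr_sub x y z : nr (x - z) <= nr (x - y) + nr (y - z).
Proof. by apply: le_trans (nrD _ _); rewrite addrA subrK. Qed.

Lemma nr_sum (I : Type) (r : seq I) (F : I -> V) (M : I -> R) :
  (forall i, nr (F i) <= M i) -> nr (\sum_(i <- r) F i) <= \sum_(i <- r) M i.
Proof.
move=> h; elim: r => [|i r ih]; first by rewrite !big_nil nr0.
by rewrite !big_cons (le_trans (nrD _ _))// lerD.
Qed.

End RealNorm.

Notation nc := (@nr _ (_[i])^o).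

Section Scalars.
Variables (R : realType).
Implicit Types z : R[i].

Lemma ncM z t : nc (z * t) = nc z * nc t.
Proof. by apply/(@complexI R); rewrite rmorphM/= -!nrE normrM. Qed.

Lemma nrZ (V : normedModType R[i]) z (x : V) : nr (z *: x) = nc z * nr x.
Proof. by apply/(@complexI R); rewrite rmorphM/= -!nrE normrZ. Qed.

Lemma nc_real (a : R) : nc (a%:C : R[i]) = `|a|.
Proof.
by apply/(@complexI R); rewrite -nrE normc_def/= expr0n addr0 sqrtr_sqr.
Qed.

Lemma nc_Re z : `|complex.Re z| <= nc z.
Proof. by rewrite /nr normc_def/= -sqrtr_sqr ler_wsqrtr// lerDl sqr_ge0. Qed.

Lemma nc_Im z : `|complex.Im z| <= nc z.
Proof. by rewrite /nr normc_def/= -sqrtr_sqr ler_wsqrtr// lerDr sqr_ge0. Qed.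

Lemma nc_ReIm z : nc z <= `|complex.Re z| + `|complex.Im z|.
Proof.
rewrite {1}(complexE z) (le_trans (nrD _ _))// ncM !nc_real.
suff -> : nc ('i : R[i]) = 1 by rewrite mul1r.
by apply/(@complexI R); rewrite -nrE normc_def/= expr0n add0r expr1n sqrtr1.
Qed.

Lemma ReB z t : complex.Re (z - t) = complex.Re z - complex.Re t.
Proof. by case: z; case: t. Qed.

Lemma ImB z t : complex.Im (z - t) = complex.Im z - complex.Im t.
Proof. by case: z; case: t. Qed.

(** A family of reals known with errors [c i] that are pairwise compatible has
    a common limit.  This replaces sequences in the proof of completeness, where
    the index is the precision itself. *)
Lemma real_between (I : Type) (i0 : I) (r c : I -> R) :
  (forall i j, r i - c i <= r j + c j) ->
  exists L, forall i, `|r i - L| <= c i.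
Proof.
move=> h; pose E := range (fun i => r i - c i).
have hE : has_sup E.
  split; first by exists (r i0 - c i0), i0.
  by exists (r i0 + c i0) => _ [i _ <-].
exists (sup E) => i.
have h1 : r i - c i <= sup E by move/ubP: (sup_upper_bound hE); apply; exists i.
have h2 : sup E <= r i + c i.
  by apply: ge_sup; [case: hE | move=> _ [j _ <-]].
rewrite ler_norml; lra.
Qed.

Lemma complex_between (I : Type) (i0 : I) (z : I -> R[i]) (c : I -> R) :
  (forall i j, nc (z i - z j) <= c i + c j) ->
  exists L, forall i, nc (z i - L) <= 2 * c i.
Proof.
move=> h.
have [|a ha] := @real_between I i0 (fun i => complex.Re (z i)) c.
  move=> i j; have := le_trans (nc_Re _) (h i j); rewrite ReB ler_norml.
  by move=> /andP[_]; lra.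
have [|b hb] := @real_between I i0 (fun i => complex.Im (z i)) c.
  move=> i j; have := le_trans (nc_Im _) (h i j); rewrite ImB ler_norml.
  by move=> /andP[_]; lra.
exists (a +i* b) => i; apply: le_trans (nc_ReIm _) _.
have := ha i; have := hb i; rewrite ReB ImB/=; lra.
Qed.

End Scalars.

(** * Closed spans of countably many weighted bounded functions *)

(** A countable family of functions [vec g] on a set of points, each bounded by
    a multiple of the weight [wt].  The norm of a function is its supremum
    relative to [wt], so a point of weight 0 forces the value 0; norms of
    spaces of functionals are of this kind, the points being the vectors. *)
Record spanData (R : realType) := SpanData {
  pt : Type;
  gen : countType;
  wt : pt -> R;
  vec : gen -> pt -> R[i];
  wt_ge0 : forall t, 0 <= wt t;
  vec_bounded : forall g, exists M, forall t, nc (vec g t) <= M * wt t }.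

Section ClosedSpan.
Variables (R : realType) (S : spanData R).
Implicit Types (cs : seq (R[i] * gen S)) (f : pt S -> R[i]).

Definition comb cs : pt S -> R[i] := fun t => \sum_(c <- cs) c.1 * vec c.2 t.

Definition inspan : {pred (pt S -> R[i])} := [pred f | `[< forall e : R, 0 < e ->
  exists cs, forall t, nc (f t - comb cs t) <= e * wt t >]].

Lemma inspanP f : reflect (forall e : R, 0 < e ->
  exists cs, forall t, nc (f t - comb cs t) <= e * wt t) (f \in inspan).
Proof. exact: asboolP. Qed.

Lemma comb_cat cs1 cs2 t : comb (cs1 ++ cs2) t = comb cs1 t + comb cs2 t.
Proof. by rewrite /comb big_cat. Qed.

Lemma comb_scale k cs t : comb [seq (k * c.1, c.2) | c <- cs] t = k * comb cs t.
Proof. by rewrite /comb big_map mulr_sumr; apply: eq_bigr => c _; rewrite mulrA. Qed.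

Lemma comb_inspan cs : comb cs \in inspan.
Proof.
by apply/inspanP => e e0; exists cs => t; rewrite subrr nr0 mulr_ge0 ?wt_ge0 ?ltW.
Qed.

Lemma inspan_submod : GRing.submod_closed inspan.
Proof.
split.
  apply/inspanP => e e0; exists [::] => t.
  by rewrite /comb big_nil subrr nr0 mulr_ge0 ?wt_ge0 ?ltW.
move=> k f g /inspanP hf /inspanP hg; apply/inspanP => e e0.
have k0 : 0 < nc k + 1 by rewrite ltr_wpDl ?nr_ge0.
have [|cs hcs] := hf (e / (2 * (nc k + 1))); first by rewrite divr_gt0 ?mulr_gt0.
have [|cs' hcs'] := hg (e / 2); first by rewrite divr_gt0.
exists ([seq (k * c.1, c.2) | c <- cs] ++ cs') => t.
rewrite comb_cat comb_scale.
have -> : (k *: f + g) t - (k * comb cs t + comb cs' t)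
        = k * (f t - comb cs t) + (g t - comb cs' t).
  by rewrite -[(_ + _) t]/(k * f t + g t); ring.
apply: le_trans (nrD _ _) _; rewrite ncM.
apply: (@le_trans _ _ (e / 2 * wt t + e / 2 * wt t)); last by lra.
apply: lerD => //; apply: (@le_trans _ _ (nc k * (e / (2 * (nc k + 1)) * wt t))).
  by rewrite ler_wpM2l ?nr_ge0.
rewrite mulrA ler_wpM2r ?wt_ge0// mulrA ler_pdivrMr ?mulr_gt0//.
have -> : e / 2 * (2 * (nc k + 1)) = nc k * e + e by field.
by rewrite lerDl ltW.
Qed.

HB.instance Definition _ :=
  GRing.isSubmodClosed.Build R[i] (pt S -> R[i]) inspan inspan_submod.

Record cspan := Cspan { cfun :> pt S -> R[i]; cfunP : cfun \in inspan }.

HB.instance Definition _ := [isSub for cfun].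
HB.instance Definition _ := [Choice of cspan by <:].
HB.instance Definition _ := [SubChoice_isSubLmodule of cspan by <:].

Lemma cspanD (x y : cspan) t : (x + y) t = x t + y t. Proof. by []. Qed.
Lemma cspanZ k (x : cspan) t : (k *: x) t = k * x t. Proof. by []. Qed.
Lemma cspan0 t : (0 : cspan) t = 0. Proof. by []. Qed.
Lemma cspanB (x y : cspan) t : (x - y) t = x t - y t. Proof. by []. Qed.
Lemma cspan_sum (I : Type) (r : seq I) (F : I -> cspan) t :
  (\sum_(i <- r) F i) t = \sum_(i <- r) F i t.
Proof. by elim: r => [|i r ih]; rewrite ?big_nil// !big_cons cspanD ih. Qed.

Lemma cspan_eq (x y : cspan) : (forall t, x t = y t) -> x = y.
Proof. by move=> h; apply/val_inj/funext. Qed.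

Definition bounds (x : cspan) : set R :=
  [set M | 0 <= M /\ forall t, nc (x t) <= M * wt t]%classic.

Definition cnorm (x : cspan) : R := inf (bounds x).

Lemma comb_bounded cs : exists2 M, 0 <= M & forall t, nc (comb cs t) <= M * wt t.
Proof.
rewrite /comb; elim: cs => [|[k g] cs [M M0 hM]].
  by exists 0 => // t; rewrite big_nil nr0 mul0r.
have [N hN] := vec_bounded g.
exists (nc k * `|N| + M) => [|t]; first by rewrite addr_ge0 ?mulr_ge0 ?nr_ge0.
rewrite big_cons (le_trans (nrD _ _))// mulrDl lerD// ncM -mulrA.
rewrite ler_wpM2l ?nr_ge0// (le_trans (hN t))// ler_wpM2r ?wt_ge0//.
exact: ler_norm.
Qed.

Implicit Types x y : cspan.

Lemma bounds_neq0 x : (bounds x !=set0)%classic.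
Proof.
have /inspanP/(_ 1 ltr01)[cs hcs] := cfunP x.
have [M M0 hM] := comb_bounded cs.
exists (1 + M); split; first by rewrite addr_ge0.
move=> t; have -> : x t = (x t - comb cs t) + comb cs t by rewrite subrK.
by rewrite (le_trans (nrD _ _))// mulrDl lerD.
Qed.

Lemma bounds_lb x : has_lbound (bounds x).
Proof. by exists 0 => M []. Qed.

Lemma cnorm_ge0 x : 0 <= cnorm x.
Proof. by apply: lb_le_inf; [exact: bounds_neq0 | move=> M []]. Qed.

Lemma cnorm_ub x t : nc (x t) <= cnorm x * wt t.
Proof.
have := wt_ge0 t; rewrite le_eqVlt => /predU1P[w0|w0].
  have [M [_ /(_ t)]] := bounds_neq0 x; by rewrite -w0 !mulr0.
rewrite -ler_pdivrMr//; apply: lb_le_inf; first exact: bounds_neq0.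
by move=> M [_ hM]; rewrite ler_pdivrMr.
Qed.

Lemma cnorm_le x M : 0 <= M -> (forall t, nc (x t) <= M * wt t) -> cnorm x <= M.
Proof. by move=> M0 hM; apply: ge_inf; [exact: bounds_lb | split]. Qed.

Lemma cnormD x y : cnorm (x + y) <= cnorm x + cnorm y.
Proof.
apply: cnorm_le => [|t]; first by rewrite addr_ge0 ?cnorm_ge0.
by rewrite cspanD (le_trans (nrD _ _))// mulrDl lerD ?cnorm_ub.
Qed.

Lemma cnormZ_le k x : cnorm (k *: x) <= nc k * cnorm x.
Proof.
apply: cnorm_le => [|t]; first by rewrite mulr_ge0 ?nr_ge0 ?cnorm_ge0.
by rewrite cspanZ ncM -mulrA ler_wpM2l ?nr_ge0 ?cnorm_ub.
Qed.

Lemma cnormZ k x : cnorm (k *: x) = nc k * cnorm x.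
Proof.
apply/eqP; rewrite eq_le cnormZ_le/=.
have [->|k0] := eqVneq k 0; first by rewrite nr0 mul0r cnorm_ge0.
have nk0 : nc k != 0 by apply: contraNneq k0 => /nr_eq0 ->.
have := cnormZ_le k^-1 (k *: x); rewrite scalerA mulVf// scale1r.
move=> /(ler_wpM2l (nr_ge0 (k : R[i]^o))); rewrite mulrA -ncM mulfV//.
suff -> : nc (1 : R[i]) = 1 by rewrite mul1r.
by rewrite /nr normr1.
Qed.

Lemma cnorm_eq0 x : cnorm x = 0 -> x = 0.
Proof.
move=> h; apply: cspan_eq => t; rewrite cspan0; apply: (@nr_eq0 _ R[i]^o).
by apply/eqP; rewrite eq_le nr_ge0 andbT; have := cnorm_ub x t; rewrite h mul0r.
Qed.

Let cN (x : cspan) : R[i] := (cnorm x)%:C.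
Let cND x y : cN (x + y) <= cN x + cN y.
Proof. by rewrite /cN -rmorphD lecR cnormD. Qed.
Let cNZ l x : cN (l *: x) = `|l| * cN x.
Proof. by rewrite /cN cnormZ (@nrE _ R[i]^o) rmorphM. Qed.
Let cN0 x : cN x = 0 -> x = 0.
Proof. by move=> /complexI/cnorm_eq0. Qed.

HB.instance Definition _ := Lmodule_isNormed.Build R[i] cspan cND cNZ cN0.

Lemma nr_cspan (x : cspan) : nr x = cnorm x.
Proof. by []. Qed.

Lemma cspan_complete (F : set_system cspan) : ProperFilter F -> cauchy F -> cvg F.
Proof.
move=> FF /cauchyP Fc.
pose I := {e : R | 0 < e}.
pose ix (e : R) (h : 0 < e) : I := exist (fun e : R => 0 < e) e h.
have /choice[u hu] : forall e : I, exists x : cspan, F (ball x (sval e)%:C).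
  by case=> e e0; apply: Fc; rewrite ltcR.
have cu (e d : I) : cnorm (u e - u d) <= sval e + sval d.
  have [z [/= ze zd]] := filter_ex (filterI (hu e) (hu d)).
  move: ze zd; rewrite -!ball_normE/= -!nr_lt !nr_cspan => ze zd.
  rewrite -nr_cspan (le_trans (nr_sub _ z _))// lerD ?ltW//.
  by rewrite nrC nr_cspan.
(* The pointwise limit; the factor 2 comes from bounding the real and the
   imaginary parts separately. *)
have /choice[L hL] : forall t, exists l, forall e : I,
    nc (u e t - l) <= 2 * (sval e * wt t).
  move=> t; apply: (complex_between (ix 1 ltr01)) => e d.
  rewrite -mulrDl (le_trans (cnorm_ub (u e - u d) t))//.
  by rewrite ler_wpM2r ?wt_ge0.
have LP : L \in inspan.
  apply/inspanP => e e0.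
  have e4 : 0 < e / 4 by rewrite divr_gt0.
  have /inspanP/(_ (e / 4) e4)[cs hcs] := cfunP (u (ix _ e4)).
  exists cs => t; have := hL t (ix _ e4); have := hcs t.
  have -> : L t - comb cs t = - (u (ix _ e4) t - L t)
     + (u (ix _ e4) t - comb cs t) by ring.
  move=> h1 h2; rewrite (le_trans (nrD _ _))// nrN /=.
  by have := wt_ge0 t; move: h1 h2 => /=; nra.
apply/cvg_ex; exists (Cspan LP); apply/fcvgrPdist_lt => e e0.
have [d ed] : exists d : R, e = d%:C.
  by exists (complex.Re e); move: e0; rewrite ltcE/= => /andP[/eqP]; case: (e) => a b /= ->.
rewrite {}ed ltcR in e0 *.
have e4 : 0 < d / 4 by rewrite divr_gt0.
apply: filterS (hu (ix _ e4)) => y.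
rewrite -ball_normE/= -!nr_lt => uy.
rewrite (le_lt_trans (nr_sub _ (u (ix _ e4)) _))//.
have : nr (Cspan LP - u (ix _ e4)) <= 2 * (d / 4).
  rewrite nr_cspan; apply: cnorm_le => [|t]; first by rewrite mulr_ge0 ?ltW.
  by rewrite -mulrA cspanB nrC; exact: hL.
lra.
Qed.

HB.instance Definition _ := Uniform_isComplete.Build cspan cspan_complete.


Lemma vec_inspan g : vec g \in inspan.
Proof.
rewrite (_ : vec g = comb [:: (1, g)]) ?comb_inspan//.
by apply/funext => t; rewrite /comb big_seq1 mul1r.
Qed.

Definition cgen g : cspan := Cspan (vec_inspan g).

(** A linear relation between values at finitely many points passes from the
    generators to their closed span.  Products and functionals being evaluations
    at points, bilinearity and equalities of functionals reduce to it. *)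
Lemma inspan_annih (r : seq (R[i] * pt S)) f : f \in inspan ->
  (forall g, \sum_(p <- r) p.1 * vec g p.2 = 0) -> \sum_(p <- r) p.1 * f p.2 = 0.
Proof.
move=> /inspanP hf r0; apply: (@nr_eq0 _ R[i]^o).
have r0' cs : \sum_(p <- r) p.1 * comb cs p.2 = 0.
  rewrite /comb; under eq_bigr => p _ do rewrite mulr_sumr.
  rewrite exchange_big big1// => c _ /=; under eq_bigr => p _ do rewrite mulrCA.
  by rewrite -mulr_sumr r0 mulr0.
pose W := \sum_(p <- r) nc p.1 * wt p.2.
have W0 : 0 <= W by apply: sumr_ge0 => p _; rewrite mulr_ge0 ?nr_ge0 ?wt_ge0.
have bd e : 0 < e -> nc (\sum_(p <- r) p.1 * f p.2) <= e * W.
  move=> e0; have [cs hcs] := hf e e0.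
  have -> : \sum_(p <- r) p.1 * f p.2 = \sum_(p <- r) p.1 * (f p.2 - comb cs p.2).
    by under [RHS]eq_bigr do rewrite mulrBr; rewrite sumrB r0' subr0.
  rewrite /W mulr_sumr; apply: nr_sum => p; rewrite ncM mulrCA.
  by rewrite ler_wpM2l ?nr_ge0.
apply/eqP; rewrite eq_le nr_ge0 andbT; apply/ler_addgt0Pr => e e0; rewrite add0r.
have W1 : 0 < W + 1 by rewrite ltr_wpDl.
have /le_trans -> // := bd (e / (W + 1)) (divr_gt0 e0 W1).
by rewrite mulrAC ler_pdivrMr// ler_pM2l// lerDl.
Qed.

Lemma cspan_approx x (e : R) : 0 < e ->
  exists cs, nr (x - \sum_(c <- cs) c.1 *: cgen c.2) <= e.
Proof.
move=> e0; have /inspanP/(_ e e0)[cs hcs] := cfunP x.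
exists cs; rewrite nr_cspan; apply: cnorm_le; first exact: ltW.
by move=> t; rewrite cspanB cspan_sum; exact: hcs.
Qed.

Lemma cspan_separable : separable cspan.
Proof.
pose Q (q : rat * rat) : R[i] := ratr q.1 +i* ratr q.2.
pose D (q : seq ((rat * rat) * gen S)) : cspan := \sum_(c <- q) Q c.1 *: cgen c.2.
have Qd (z : R[i]) (e : R) : 0 < e -> exists q, nc (z - Q q) <= e.
  case: z => a b e0.
  have [|p hp] := @rat_in_itvoo R (a - e / 2) (a + e / 2); first by lra.
  have [|q hq] := @rat_in_itvoo R (b - e / 2) (b + e / 2); first by lra.
  exists (p, q); rewrite (le_trans (nc_ReIm _))// ReB ImB /=.
  move: hp hq; rewrite !in_itv/= => /andP[p1 p2] /andP[q1 q2].
  have h1 : `|a - ratr p| <= e / 2 by rewrite ler_norml; apply/andP; split; lra.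
  have h2 : `|b - ratr q| <= e / 2 by rewrite ler_norml; apply/andP; split; lra.
  lra.
have DQ cs (e : R) : 0 < e -> exists q, nr (\sum_(c <- cs) c.1 *: cgen c.2 - D q) <= e.
  elim: cs e => [|[z g] cs ih] e e0.
    by exists [::]; rewrite /D !big_nil subrr nr0 ltW.
  have [|q hq] := ih (e / 2); first by rewrite divr_gt0.
  have n0 : 0 < nr (cgen g) + 1 by rewrite ltr_wpDl ?nr_ge0.
  have [|r hr] := Qd z (e / 2 / (nr (cgen g) + 1)); first by rewrite !divr_gt0.
  exists ((r, g) :: q); rewrite /D !big_cons /= opprD addrACA -scalerBl.
  rewrite (le_trans (nrD _ _))// nrZ.
  suff : nc (z - Q r) * nr (cgen g) <= e / 2 by move: hq; rewrite /D; lra.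
  apply: (@le_trans _ _ (e / 2 / (nr (cgen g) + 1) * (nr (cgen g) + 1))).
    by apply: ler_pM; rewrite ?nr_ge0// lerDl.
  by rewrite divfK// gt_eqF.
exists (range D); first by apply: card_le_trans (card_image_le _ _) _; exact: countableP.
move=> O [x Ox] Oo; have /nbhs_ballP[e /= e0 xe] : nbhs x O by apply: open_nbhs_nbhs; split.
have [d ed] : exists d : R, e = d%:C.
  by exists (complex.Re e); move: e0; rewrite ltcE/= => /andP[/eqP]; case: (e) => a b /= ->.
move: e0 xe; rewrite {}ed ltcR => d0 xe.
have [|cs hcs] := @cspan_approx x (d / 4); first by rewrite divr_gt0.
have [|q hq] := DQ cs (d / 4); first by rewrite divr_gt0.
exists (D q); split; last by exists q.
apply: xe; rewrite -ball_normE/= -nr_lt.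
apply: le_lt_trans (nr_sub _ (\sum_(c <- cs) c.1 *: cgen c.2) _) _.
lra.
Qed.

End ClosedSpan.

(** * Sign vectors with small correlations *)

(** A letter is a vector of the plane over the field with two elements.  The
    indices of level [n] are the [4 ^ n] words of length [n].  The head of a
    word is its last coordinate, so that level [n.+1] extends level [n] by one
    letter in front. *)
Definition letter : countType := (bool * bool)%type.
Definition letters : seq letter :=
  [:: (false, false); (false, true); (true, false); (true, true)].

Fixpoint words n : seq (seq letter) :=
  if n is m.+1 then [seq x :: v | v <- words m, x <- letters] else [:: [::]].

Lemma mem_words n v : (v \in words n) = (size v == n).
Proof.
elim: n v => [|n ih] v; first by rewrite inE -size_eq0.
apply/idP/eqP => [/allpairsP[[v' x] /= [+ _ ->]]|].
  by rewrite ih /= => /eqP ->.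
case: v => [//|x v] [sv]; apply/allpairsP; exists (v, x); split=> //=.
  by rewrite ih sv.
by case: x => [[] []].
Qed.

Lemma big_words (M : nmodType) n (F : seq letter -> M) :
  \sum_(v <- words n.+1) F v = \sum_(v <- words n) \sum_(x <- letters) F (x :: v).
Proof. exact: big_allpairs_dep. Qed.

Lemma size_words n : size (words n) = (4 ^ n)%N.
Proof. by elim: n => [//|n ih]; rewrite [LHS]size_allpairs ih expnSr. Qed.

Section Correlations.
Variable R : realFieldType.
Implicit Types (c e t : bool) (w x : letter) (l v i j L : seq letter).

(** A quadratic phase if [c] holds, a character otherwise. *)
Definition chi c w x : R :=
  (-1) ^+ ((c && x.1 && x.2) (+) (w.1 && x.1) (+) (w.2 && x.2)).

Fixpoint phi (lam : nat -> bool) l v : R :=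
  match l, v with
  | w :: l', x :: v' => phi lam l' v' * chi (lam (size v')) w x
  | _, _ => 1
  end.

Lemma chi_orth c w w' :
  \sum_(x <- letters) chi c w x * chi c w' x = 4 * (w == w')%:R.
Proof.
rewrite /letters !big_cons big_nil /chi.
by case: c; case: w => [[] []]; case: w' => [[] []] /=; rewrite ?expr0 ?expr1; ring.
Qed.

(** Two bases with different [c] are mutually unbiased: the Gauss sum of a
    nondegenerate quadratic form on four points has absolute value 2. *)
Lemma chi_flat c c' w w' : c != c' ->
  `|\sum_(x <- letters) chi c w x * chi c' w' x| <= 2.
Proof.
rewrite /letters !big_cons big_nil /chi.
by case: c; case: c' => // _; case: w => [[] []]; case: w' => [[] []] /=;
  rewrite ?expr0 ?expr1 ler_norml; apply/andP; split; lra.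
Qed.

Lemma chi_le c c' w w' : `|\sum_(x <- letters) chi c w x * chi c' w' x| <= 4.
Proof.
apply: le_trans (ler_norm_sum _ _ _) _.
rewrite (eq_bigr (fun=> 1)) => [|x _].
  by rewrite big_const_seq /= ; lra.
by rewrite /chi normrM !normrX !normrN1 !expr1n mulr1.
Qed.

Definition corr lam mu n l l' := \sum_(v <- words n) phi lam l v * phi mu l' v.

Lemma corrS lam mu n w l w' l' : corr lam mu n.+1 (w :: l) (w' :: l') =
  corr lam mu n l l' * \sum_(x <- letters) chi (lam n) w x * chi (mu n) w' x.
Proof.
rewrite /corr big_words mulr_suml [in RHS]big_seq [in LHS]big_seq.
apply: eq_bigr => v; rewrite mem_words => /eqP sv.
by rewrite mulr_sumr; apply: eq_bigr => x _ /=; rewrite sv mulrACA.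
Qed.

Lemma corr_diag lam n l l' : size l = n -> size l' = n ->
  corr lam lam n l l' = 4 ^+ n * (l == l')%:R.
Proof.
elim: n l l' => [|n ih] [|w l] [|w' l'] // => [_ _|[sl] [sl']].
  by rewrite /corr big_seq1 /= expr0 !mulr1.
rewrite corrS ih// chi_orth eqseq_cons exprSr.
by case: (w == w'); case: (l == l'); rewrite ?mulr0 ?mul0r ?mulr1.
Qed.

(** The correlation factors over the coordinates; each coordinate congruent to
    [k] modulo 5 contributes a factor 1/2, and there are at least [n %/ 5] of
    them. *)
Lemma corr_flat k lam mu n l l' : (k < 5)%N ->
  (forall u, u %% 5 = k -> lam u != mu u)%N -> size l = n -> size l' = n ->
  `|corr lam mu n l l'| <= 4 ^+ n / 2 ^+ (n %/ 5).
Proof.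
move=> k5 hk sl sl'.
(* The exact number of [u < n] with [u %% 5 = k] is [(n + (4 - k)) %/ 5]. *)
suff : `|corr lam mu n l l'| <= 4 ^+ n / 2 ^+ ((n + (4 - k)) %/ 5).
  move=> h; apply: le_trans h _; rewrite ler_pM2l ?exprn_gt0//.
  rewrite lef_pV2 ?posrE ?exprn_gt0// ler_eXn2l ?ltr1n//.
  by apply: leq_div2r; rewrite leq_addr.
elim: n l l' sl sl' => [|n ih] [|w l] [|w' l'] // => [_ _|[sl] [sl']].
  rewrite /corr big_seq1 /= mulr1 normr1 divn_small ?expr0 ?divr1//; lia.
rewrite corrS normrM.
have [nk|nk] := eqVneq (n %% 5)%N k.
  have -> : ((n.+1 + (4 - k)) %/ 5 = ((n + (4 - k)) %/ 5).+1)%N by lia.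
  apply: (@le_trans _ _ (4 ^+ n / 2 ^+ ((n + (4 - k)) %/ 5) * 2)).
    by apply: ler_pM => //; [exact: ih | exact: chi_flat (hk _ nk)].
  rewrite !exprSr invfM le_eqVlt; apply/orP; left; apply/eqP.
  by field; rewrite expf_neq0.
have -> : ((n.+1 + (4 - k)) %/ 5 = (n + (4 - k)) %/ 5)%N by lia.
rewrite exprSr mulrAC; apply: ler_pM => //; [exact: ih | exact: chi_le].
Qed.

Lemma chi_dual c c' x x' : \sum_(w <- letters) chi c w x * chi c' w x' =
  4 * (x == x')%:R * (-1) ^+ ((c (+) c') && x.1 && x.2).
Proof.
rewrite /letters !big_cons big_nil /chi.
by case: c; case: c'; case: x => [[] []]; case: x' => [[] []] /=; rewrite ?expr0 ?expr1; ring.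
Qed.

(** The sign left over by summing out the linear parts of two phases whose
    quadratic parts differ by [d]. *)
Fixpoint twist (d : nat -> bool) v : R :=
  if v is x :: v' then twist d v' * (-1) ^+ (d (size v') && x.1 && x.2) else 1.

Lemma twist_ext d d' v : d =1 d' -> twist d v = twist d' v.
Proof. by move=> h; elim: v => [//|x v ih] /=; rewrite ih h. Qed.

Lemma twist0 d v : d =1 xpred0 -> twist d v = 1.
Proof. by move=> h; elim: v => [//|x v ih] /=; rewrite ih h/= expr0 mulr1. Qed.

Lemma phi_dual lam mu n v v' : size v = n -> size v' = n ->
  \sum_(l <- words n) phi lam l v * phi mu l v' =
  4 ^+ n * (v == v')%:R * twist (fun u => lam u (+) mu u) v.
Proof.
elim: n v v' => [|n ih] [|x v] [|x' v'] // => [_ _|[sv] [sv']].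
  by rewrite big_seq1 /= !mulr1.
rewrite big_words; under eq_bigr => l _.
  under eq_bigr => w _ do rewrite /= sv sv' mulrACA.
  rewrite -mulr_sumr chi_dual; over.
rewrite -mulr_suml ih// eqseq_cons /= sv exprSr.
by case: (x == x'); case: (v == v'); rewrite ?mulr0 ?mul0r ?mulr0 ?mulr1//; ring.
Qed.

(** A point of block [n] is a word [w :: l] of length [n.+1] with a bit [t].
    As seen from level [n] it carries the label [(e, w, t)], as seen from level
    [n.+1] the label [(e, t)]; the first bit of the codes separates the two
    roles that a level plays in the blocks on its two sides, and [e] is the bit
    of the sequence that indexes the algebra. *)
Definition locode e w t u := nth false [:: true; e; w.1; w.2; t] (u %% 5).
Definition hicode e t u := nth false [:: false; e; false; false; t] (u %% 5).

(** The value at a point [h] of block [n] of the function attached to an index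
    [i] of level [n]; [hichar] is the same for level [n.+1].  The sign
    [(-1) ^+ h.2] makes the two families orthogonal on block [n]
    ([lohi_orth]). *)
Definition lochar e i (h : seq letter * bool) : R :=
  let w := head (false, false) h.1 in
  (-1) ^+ h.2 * phi (locode e w h.2) (behead h.1) i.

Definition hichar e j (h : seq letter * bool) : R :=
  phi (hicode e h.2) (behead h.1) (behead j) *
  chi false (head (false, false) h.1) (head (false, false) j).

Lemma chi_norm c w x : `|chi c w x| = 1.
Proof. by rewrite normrX normrN1 expr1n. Qed.

Lemma phi_norm lam l v : `|phi lam l v| = 1.
Proof.
elim: v l => [|x v ih] [|w l] /=; rewrite ?normr1//.
by rewrite normrM ih chi_norm mulr1.
Qed.

Lemma lochar_norm e i h : `|lochar e i h| = 1.
Proof. by rewrite normrM normrX normrN1 expr1n phi_norm mulr1. Qed.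

Lemma hichar_norm e j h : `|hichar e j h| = 1.
Proof. by rewrite normrM phi_norm chi_norm mulr1. Qed.

Definition points n : seq (seq letter * bool) :=
  [seq (L, t) | L <- words n.+1, t <- [:: false; true]].

Lemma big_points (M : nmodType) n (F : seq letter * bool -> M) :
  \sum_(h <- points n) F h =
  \sum_(w <- letters) \sum_(t <- [:: false; true]) \sum_(l <- words n) F (w :: l, t).
Proof.
rewrite big_allpairs big_words exchange_big /=.
by apply: eq_bigr => w _; rewrite exchange_big.
Qed.

Lemma mem_points n L t : ((L, t) \in points n) = (size L == n.+1).
Proof.
apply/idP/idP => [/allpairsP[[L' t'] [+ _ [-> _]]]|sL]; first by rewrite mem_words.
by apply/allpairsP; exists (L, t); split; rewrite ?mem_words//=; case: t.
Qed.

Lemma size_points n : size (points n) = (2 * 4 ^ n.+1)%N.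
Proof. by rewrite size_allpairs size_words mulnC. Qed.

Lemma pointsP n h : h \in points n -> exists w l t, size l = n /\ h = (w :: l, t).
Proof.
by case: h => [[|w l] t]; rewrite mem_points // => /eqP[sl]; exists w, l, t.
Qed.

Lemma wordsP n v : v \in words n.+1 -> exists x v', size v' = n /\ v = x :: v'.
Proof. by rewrite mem_words; case: v => [//|x v'] /eqP[sv]; exists x, v'. Qed.

Lemma lochar_orth e n i i' : i \in words n -> i' \in words n ->
  \sum_(h <- points n) lochar e i h * lochar e i' h = (2 * 4 ^+ n.+1) * (i == i')%:R.
Proof.
rewrite !mem_words => /eqP si /eqP si'; rewrite big_points.
rewrite (eq_bigr (fun=> 2 * 4 ^+ n * (i == i')%:R)) => [|w _].
  by rewrite !big_cons big_nil exprSr; ring.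
rewrite (eq_bigr (fun=> 4 ^+ n * (i == i')%:R)) => [|t _].
  by rewrite !big_cons big_nil; ring.
rewrite (eq_bigr (fun l => phi (locode e w t) l i * phi (locode e w t) l i')).
  by rewrite phi_dual// twist0 ?mulr1// => u; rewrite addbb.
by move=> l _; rewrite /lochar /= mulrACA -expr2 sqrr_sign mul1r.
Qed.

Lemma hichar_orth e n j j' : j \in words n.+1 -> j' \in words n.+1 ->
  \sum_(h <- points n) hichar e j h * hichar e j' h = (2 * 4 ^+ n.+1) * (j == j')%:R.
Proof.
move=> /wordsP[x [v [sv ->]]] /wordsP[x' [v' [sv' ->]]].
rewrite big_points; under eq_bigr => w _.
  rewrite (eq_bigr (fun=> 4 ^+ n * (v == v')%:R *
      (chi false w x * chi false w x'))) => [|t _]; last first.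
    under eq_bigr => l _ do rewrite /hichar /= mulrACA.
    by rewrite -mulr_suml phi_dual// twist0 ?mulr1// => u; rewrite addbb.
  rewrite !big_cons big_nil addr0 -mulrDl; over.
rewrite -mulr_sumr chi_dual /= expr0 eqseq_cons exprSr.
by case: (x == x'); case: (v == v'); rewrite ?mulr0 ?mul0r ?mulr0 ?mulr1//; ring.
Qed.

(** The letters being summed out, only the quadratic phases and the sign
    [(-1) ^+ t] depend on [t]; the two codes change in the same coordinates
    with [t], so their phases compensate and the sum over [t] vanishes. *)
Lemma lohi_orth e n i j : i \in words n -> j \in words n.+1 ->
  \sum_(h <- points n) lochar e i h * hichar e j h = 0.
Proof.
rewrite mem_words => /eqP si /wordsP[x [v [sv ->]]].
rewrite big_points big1// => w _.
have E t : \sum_(l <- words n) lochar e i (w :: l, t) * hichar e (x :: v) (w :: l, t)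
   = (-1) ^+ t * (4 ^+ n * (i == v)%:R * chi false w x *
       twist (fun u => locode e w false u (+) hicode e false u) i).
  rewrite /lochar /hichar /=.
  rewrite (eq_bigr (fun l => phi (locode e w t) l i * phi (hicode e t) l v *
      ((-1) ^+ t * chi false w x))) => [|l _]; last by ring.
  rewrite -mulr_suml phi_dual// (@twist_ext _ (fun u => locode e w false u (+) hicode e false u)).
    by ring.
  by move=> u; rewrite /locode /hicode; case: (u %% 5)%N => [|[|[|[|[|m]]]]] //=; case: t.
by rewrite !big_cons big_nil !E expr0 expr1; ring.
Qed.

(** The bound on correlations at level [n], up to a factor 2. *)
Definition delta n : R := (2 ^+ (n %/ 5))^-1.

Lemma delta_gt0 n : 0 < delta n.
Proof. by rewrite invr_gt0 exprn_gt0. Qed.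

Lemma locode_corr e e' w w' t t' n l l' : size l = n -> size l' = n ->
  (e, w, t) != (e', w', t') ->
  `|corr (locode e w t) (locode e' w' t') n l l'| <= 4 ^+ n * delta n.
Proof.
move=> sl sl' neq.
have [k k5 hk] : exists2 k, (k < 5)%N & nth false [:: true; e; w.1; w.2; t] k
    != nth false [:: true; e'; w'.1; w'.2; t'] k.
  have [e_e|?] := eqVneq e e'; last by exists 1%N.
  have [w_w|?] := eqVneq w.1 w'.1; last by exists 2%N.
  have [w2|?] := eqVneq w.2 w'.2; last by exists 3%N.
  have [t_t|?] := eqVneq t t'; last by exists 4%N.
  by move: neq; rewrite e_e t_t (surjective_pairing w) w_w w2 -surjective_pairing eqxx.
by apply: (corr_flat k5) => // u uk; rewrite /locode uk.
Qed.

Lemma hicode_corr e e' t t' n l l' : size l = n -> size l' = n ->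
  (e, t) != (e', t') ->
  `|corr (hicode e t) (hicode e' t') n l l'| <= 4 ^+ n * delta n.
Proof.
move=> sl sl' neq.
have [k k5 hk] : exists2 k, (k < 5)%N & nth false [:: false; e; false; false; t] k
    != nth false [:: false; e'; false; false; t'] k.
  have [e_e|?] := eqVneq e e'; last by exists 1%N.
  have [t_t|?] := eqVneq t t'; last by exists 4%N.
  by move: neq; rewrite e_e t_t eqxx.
by apply: (corr_flat k5) => // u uk; rewrite /hicode uk.
Qed.

Lemma lohi_corr e e' w t t' n l l' : size l = n -> size l' = n ->
  `|corr (locode e w t) (hicode e' t') n l l'| <= 4 ^+ n * delta n.
Proof.
by move=> sl sl'; apply: (@corr_flat 0) => // u u0; rewrite /locode /hicode u0.
Qed.

Definition aver n (F : seq letter -> R) : R := (4 ^+ n)^-1 * \sum_(v <- words n) F v.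

Lemma aver_le n F (M : R) : `|\sum_(v <- words n) F v| <= 4 ^+ n * M ->
  `|aver n F| <= M.
Proof.
move=> h; rewrite /aver normrM ger0_norm ?invr_ge0 ?exprn_ge0//.
by rewrite ler_pdivrMl ?exprn_gt0.
Qed.

Lemma lochar_sum e e' w w' t t' n l l' :
  \sum_(i <- words n) lochar e i (w :: l, t) * lochar e' i (w' :: l', t') =
  (-1) ^+ t * (-1) ^+ t' * corr (locode e w t) (locode e' w' t') n l l'.
Proof.
by rewrite mulr_sumr; apply: eq_bigr => i _; rewrite /lochar /= mulrACA.
Qed.

Lemma hichar_sum e e' w w' t t' n l l' :
  \sum_(j <- words n.+1) hichar e j (w :: l, t) * hichar e' j (w' :: l', t') =
  corr (hicode e t) (hicode e' t') n l l' * (4 * (w == w')%:R).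
Proof.
rewrite big_words mulr_suml; apply: eq_bigr => v _.
by rewrite -(chi_orth false) mulr_sumr; apply: eq_bigr => x _; rewrite /hichar /= mulrACA.
Qed.

Lemma lohi_sum e e' w w' w'' t t' n l l' :
  \sum_(i <- words n.+1) lochar e i ([:: w'', w & l], t) * hichar e' i (w' :: l', t') =
  (-1) ^+ t * (corr (locode e w'' t) (hicode e' t') n l l' *
    \sum_(x <- letters) chi (locode e w'' t n) w x * chi false w' x).
Proof.
rewrite big_words mulr_suml mulr_sumr [in LHS]big_seq [in RHS]big_seq.
apply: eq_bigr => v; rewrite mem_words => /eqP sv.
rewrite !mulr_sumr; apply: eq_bigr => x _; rewrite /lochar /hichar /= sv; ring.
Qed.

Lemma lochar_flat e e' n h g : h \in points n -> g \in points n -> e != e' ->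
  `|aver n (fun i => lochar e i h * lochar e' i g)| <= delta n.
Proof.
move=> /pointsP[w [l [t [sl ->]]]] /pointsP[w' [l' [t' [sl' ->]]]] ee'.
apply: aver_le; rewrite lochar_sum !normrM !normrX !normrN1 !expr1n !mul1r.
by apply: locode_corr => //; rewrite !xpair_eqE (negPf ee').
Qed.

Lemma lohi_flat e e' n h g : h \in points n.+1 -> g \in points n ->
  `|aver n.+1 (fun i => lochar e i h * hichar e' i g)| <= delta n.
Proof.
move=> /pointsP[w [l0 [t [sl ->]]]] /pointsP[w' [l' [t' [sl' ->]]]].
case: l0 sl => [//|w1 l] [sl].
apply: aver_le; rewrite lohi_sum !normrM normrX normrN1 expr1n mul1r.
rewrite exprSr mulrAC; apply: ler_pM => //; [exact: lohi_corr | exact: chi_le].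
Qed.

(** For equal labels, the sign vectors of block [n] have the same Gram matrix in
    level [n] as in level [n.+1]: points with the same [(w, t)] are orthonormal
    in both.  For different labels all correlations are small on their own. *)
Lemma lohi_match e e' n h g : h \in points n -> g \in points n ->
  `|aver n (fun i => lochar e i h * lochar e' i g) -
    aver n.+1 (fun j => hichar e j h * hichar e' j g)| <= 2 * delta n.
Proof.
move=> /pointsP[w [l [t [sl ->]]]] /pointsP[w' [l' [t' [sl' ->]]]].
have d0 := delta_gt0 n.
have Bflat : (e, t) != (e', t') ->
   `|aver n.+1 (fun j => hichar e j (w :: l, t) * hichar e' j (w' :: l', t'))| <= delta n.
  move=> et; apply: aver_le; rewrite hichar_sum normrM exprSr mulrAC.
  apply: ler_pM => //; first exact: hicode_corr.
  by case: (w == w') => /=; rewrite ?mulr1 ?mulr0 ?normr0// ger0_norm.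
have Aflat : (e, w, t) != (e', w', t') ->
   `|aver n (fun i => lochar e i (w :: l, t) * lochar e' i (w' :: l', t'))| <= delta n.
  move=> et; apply: aver_le; rewrite lochar_sum !normrM !normrX !normrN1 !expr1n !mul1r.
  exact: locode_corr.
have [[ee tt]|et] := eqVneq (e, t) (e', t'); last first.
  have ewt : (e, w, t) != (e', w', t').
    by apply: contraNneq et => -[-> _ ->].
  rewrite (le_trans (ler_normB _ _))//; have := Aflat ewt; have := Bflat et; lra.
subst e' t'; have [ww|ww] := eqVneq w w'.
  subst w'; rewrite /aver lochar_sum hichar_sum !corr_diag// eqxx mulr1.
  rewrite -expr2 sqrr_sign mul1r exprSr.
  suff -> : (4 ^+ n)^-1 * (4 ^+ n * (l == l')%:R) -
    (4 ^+ n * 4)^-1 * (4 ^+ n * (l == l')%:R * 4) = 0 :> R by rewrite normr0 mulr_ge0// ltW.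
  by field; rewrite expf_neq0.
rewrite {2}/aver hichar_sum (negPf ww) !mulr0 subr0.
apply: le_trans (Aflat _) _; last by lra.
by rewrite !xpair_eqE (negPf ww) andbF.
Qed.

End Correlations.

(** * The algebra of a sequence of bits *)

Section Algebra.
Variables (R : realType) (s : nat -> bool).

(** A site is a block number with a point; only sites with the point in that
    block matter, and [xfun] vanishes at the others. *)
Definition site : countType := (nat * (seq letter * bool))%type.

(** An index [i] of level [k] gives a function supported by the blocks [k]
    and [k.-1]. *)
Definition xfun (k : nat * seq letter) (g : site) : R[i] :=
  if (k.2 \in words k.1) && (g.2 \in points g.1) then
    (if g.1 == k.1 then lochar R (s g.1) k.2 g.2
     else if g.1.+1 == k.1 then hichar R (s g.1) k.2 g.2 else 0)%:C
  else 0.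

Lemma xfun_le k g : nc (xfun k g) <= 1.
Proof.
rewrite /xfun; case: ifP => _; last by rewrite nr0.
rewrite nc_real; case: ifP => _; first by rewrite lochar_norm.
by case: ifP => _; rewrite ?hichar_norm ?normr0.
Qed.

Lemma xfun_bounded k : exists M, forall g, nc (xfun k g) <= M * 1.
Proof. by exists 1 => g; rewrite mulr1 xfun_le. Qed.

Definition xdata : spanData R :=
  @SpanData R site (nat * seq letter)%type (fun=> 1) xfun (fun=> ler01) xfun_bounded.

(** The points of the algebra at which functionals are evaluated are pairs
    [(x, r)] with [x] in the space [X] and [r] any bound on its norm; carrying
    [r] along makes weights available without a supremum.  Other pairs get the
    weight 0. *)
Definition good (x : site -> R[i]) (r : R) : bool :=
  (x \in @inspan R xdata) && `[< forall g, nc (x g) <= r >].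

Definition apoint : Type := (site + (((site -> R[i]) * R) + unit))%type.
Definition agen : countType := ((nat * seq letter) + (site + unit))%type.

(** An element of the algebra is a triple, seen as a function on three kinds
    of points: its values at sites are its component in [X], its values at
    pairs [(x, r)] are its component in [Y] evaluated at [x], and its last
    value is the coefficient of [omega].  The weight 2 of the last point makes
    the norm submultiplicative, as the product has two terms. *)
Definition awt (t : apoint) : R :=
  match t with
  | inl _ => 1
  | inr (inl (x, r)) => if good x r then r else 0
  | inr (inr _) => 2
  end.

Definition avec (g : agen) (t : apoint) : R[i] :=
  match g, t with
  | inl k, inl h => xfun k h
  | inr (inl h), inr (inl (x, r)) => if good x r then x h else 0
  | inr (inr _), inr (inr _) => 1
  | _, _ => 0
  end.

Lemma goodP x r g : good x r -> nc (x g) <= r.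
Proof. by case/andP => _ /asboolP. Qed.

Lemma good_ge0 x r : good x r -> 0 <= r.
Proof. by move=> /(goodP (0%N, ([::], false))); apply: le_trans; exact: nr_ge0. Qed.

Lemma awt_ge0 t : 0 <= awt t.
Proof.
by case: t => [//|[[x r]|[]]] //=; case: ifP => // /good_ge0.
Qed.

Lemma avec_bounded g : exists M, forall t, nc (avec g t) <= M * awt t.
Proof.
exists 1 => t; rewrite mul1r; have := awt_ge0 t.
case: g t => [k|[h|[]]] [h'|[[x r]|[]]] /=; rewrite ?nr0// => _.
- exact: xfun_le.
- by case: ifP => [/goodP->//|]; rewrite nr0.
- by rewrite /nr normr1 ler1n.
Qed.

Definition adata : spanData R := SpanData awt_ge0 avec_bounded.

Definition alg := cspan adata.
HB.instance Definition _ := CompleteNormedModule.copy alg (cspan adata).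
Implicit Types f g : alg.

Lemma algD f g t : (f + g) t = f t + g t. Proof. by []. Qed.
Lemma algZ k f t : (k *: f) t = k * f t. Proof. by []. Qed.

Definition omega : alg := cgen (inr (inr tt) : gen adata).
Definition xel n i : alg := cgen (inl (n, i) : gen adata).
Definition del n (h : seq letter * bool) : alg := cgen (inr (inl (n, h)) : gen adata).

Definition xpart f (g : site) : R[i] := f (inl g).

Lemma xpart_inspan f : xpart f \in @inspan R xdata.
Proof.
apply/inspanP => e e0; have /inspanP/(_ e e0)[cs hcs] := cfunP f.
have [cs' hcs'] : exists cs', forall g : site, comb cs (inl g) = @comb R xdata cs' g.
  rewrite /comb; elim: (cs) => [|[c [k|u]] l [cs' ih]].
  - by exists [::] => g; rewrite !big_nil.
  - by exists ((c, k) :: cs') => g; rewrite !big_cons ih.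
  - by exists cs' => g; rewrite big_cons ih /=; case: (u) => ?; rewrite mulr0 add0r.
by exists cs' => g; rewrite -hcs'; exact: hcs (inl g).
Qed.

Lemma xpart_good f : good (xpart f) (nr f).
Proof.
rewrite /good xpart_inspan; apply/asboolP => g.
by have := cnorm_ub f (inl g); rewrite mulr1.
Qed.

(** The component of [f] in [Y] evaluated at the component of [g] in [X]. *)
Definition pairing f g : R[i] := f (inr (inl (xpart g, nr g))).

Lemma pairing_le f g : nc (pairing f g) <= nr f * nr g.
Proof. by have := cnorm_ub f (inr (inl (xpart g, nr g))); rewrite /= xpart_good. Qed.

Lemma pairingD f g h : pairing f (g + h) = pairing f g + pairing f h.
Proof.
apply/eqP; rewrite -subr_eq0; apply/eqP.
pose p g : pt adata := inr (inl (xpart g, nr g)).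
have := @inspan_annih R adata [:: (1, p (g + h)); (-1, p g); (-1, p h)] f (cfunP f).
rewrite !big_cons big_nil /= !mul1r !mulN1r addr0 /pairing opprD => -> // k.
rewrite !big_cons big_nil /= !mul1r !mulN1r addr0.
case: k => [k|[u|[]]]; rewrite /= ?oppr0 ?addr0// !xpart_good.
by apply: (@etrans _ _ (g (inl u) + h (inl u) + (- g (inl u) - h (inl u)))); last ring.
Qed.

Lemma pairingZ f k g : pairing f (k *: g) = k * pairing f g.
Proof.
apply/eqP; rewrite -subr_eq0; apply/eqP.
pose p g : pt adata := inr (inl (xpart g, nr g)).
have := @inspan_annih R adata [:: (1, p (k *: g)); (- k, p g)] f (cfunP f).
rewrite !big_cons big_nil /= !mul1r !mulNr addr0 /pairing => -> // u.
rewrite !big_cons big_nil /= !mul1r !mulNr addr0.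
case: u => [u|[u|[]]]; rewrite /= ?mulr0 ?oppr0 ?addr0// !xpart_good.
by apply: (@etrans _ _ (k * g (inl u) - k * g (inl u))); last ring.
Qed.

Lemma pairing_omega f : pairing f omega = 0.
Proof.
pose p g : pt adata := inr (inl (xpart g, nr g)).
have := @inspan_annih R adata [:: (1, p omega)] f (cfunP f).
rewrite !big_seq1 /= !mul1r; apply => u; rewrite big_seq1 mul1r.
by case: u => [u|[u|[]]] //=; rewrite xpart_good.
Qed.

Definition amul f g : alg := (pairing f g + pairing g f) *: omega.

Lemma amulC : commutative amul.
Proof. by move=> f g; rewrite /amul addrC. Qed.

Lemma amul_omega f k : amul f (k *: omega) = 0.
Proof.
by rewrite /amul pairingZ pairing_omega /pairing algZ !mulr0 addr0 scale0r.
Qed.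

Lemma amulA : associative amul.
Proof. by move=> f g h; rewrite amul_omega amulC amul_omega. Qed.

Lemma amulDl : left_distributive amul +%R.
Proof.
move=> f g h; rewrite /amul pairingD -scalerDl; congr (_ *: _).
by rewrite {1}/pairing algD addrACA.
Qed.

Lemma amulDr : right_distributive amul +%R.
Proof. by move=> f g h; rewrite !(amulC f) amulDl. Qed.

Lemma amulZl k f g : amul (k *: f) g = k *: amul f g.
Proof.
rewrite /amul pairingZ scalerA; congr (_ *: _).
by rewrite {1}/pairing algZ mulrDr.
Qed.

Lemma amulZr k f g : amul f (k *: g) = k *: amul f g.
Proof. by rewrite !(amulC f) amulZl. Qed.

Lemma omega_norm : nr omega <= 1 / 2.
Proof.
rewrite nr_cspan; apply: cnorm_le => [//|t].
case: t => [h|[[x r]|[]]] /=; rewrite ?nr0 ?mulr1//.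
- by rewrite mulr_ge0 ?(awt_ge0 (inr (inl (x, r)))).
- by rewrite divfK// /nr normr1.
Qed.

Lemma amul_norm f g : `|amul f g| <= `|f| * `|g|.
Proof.
rewrite !nrE -rmorphM lecR /amul nrZ.
have h1 := pairing_le f g; have h2 := pairing_le g f.
have h3 := omega_norm.
have h4 := nrD (pairing f g : R[i]^o) (pairing g f).
have := nr_ge0 omega; have := nr_ge0 (pairing f g + pairing g f : R[i]^o).
nra.
Qed.

HB.instance Definition _ := isBanachAlgebra.Build R[i] alg
  amulA amulDl amulDr amulZl amulZr amul_norm.

Lemma alg_separable : separable alg.
Proof. exact: cspan_separable. Qed.

Lemma alg_commutative : bcommutative alg.
Proof. exact: amulC. Qed.

Lemma omega_neq0 : omega <> 0.
Proof.
by move=> /(congr1 (fun f : alg => f (inr (inr tt)))) /eqP; rewrite /= oner_eq0.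
Qed.

Lemma del_norm n (h : seq letter * bool) : nr (del n h) <= 1.
Proof.
rewrite nr_cspan; apply: cnorm_le => // t; rewrite mul1r.
case: t => [h'|[[x r]|[]]] /=; rewrite ?nr0//.
by case: ifP => [/goodP->//|]; rewrite nr0.
Qed.

Lemma xel_norm n i : nr (xel n i) <= 1.
Proof.
rewrite nr_cspan; apply: cnorm_le => // t; rewrite mul1r.
case: t => [h'|[[x r]|[]]] /=; rewrite ?nr0//; first exact: xfun_le.
exact: (awt_ge0 (inr (inl (x, r)))).
Qed.


Definition npoints n : R := 2 * 4 ^+ n.+1.

Lemma npoints_gt0 n : 0 < npoints n.
Proof. by rewrite mulr_gt0 ?exprn_gt0. Qed.

Lemma lochar_xfun n i k : i \in words n ->
  \sum_(h <- points n) (lochar R (s n) i h)%:C * xfun k (n, h) =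
  (if k == (n, i) then npoints n else 0)%:C.
Proof.
case: k => m j iw; have [jw|jw] := boolP (j \in words m); last first.
  rewrite big1 => [|h _]; last by rewrite /xfun (negPf jw) mulr0.
  by case: eqP => // -[mn ji]; rewrite mn ji iw in jw.
rewrite big_seq (eq_bigr (fun h => (lochar R (s n) i h * (if n == m then lochar R (s n) j h
     else if n.+1 == m then hichar R (s n) j h else 0))%:C)); last first.
  by move=> h hp; rewrite /xfun /= jw hp /= [RHS]rmorphM.
rewrite -big_seq -rmorph_sum; congr (_%:C); rewrite xpair_eqE [n == m]eq_sym.
have [nm|nm] := eqVneq m n.
  subst m; rewrite (lochar_orth R (s n) iw jw) eq_sym /npoints.
  by case: eqP => _; rewrite ?mulr1 ?mulr0.
have [nm'|nm'] := eqVneq n.+1 m; first by subst m; rewrite lohi_orth.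
by rewrite big1// => h _; rewrite mulr0.
Qed.

Lemma hichar_xfun n i k : i \in words n.+1 ->
  \sum_(h <- points n) (hichar R (s n) i h)%:C * xfun k (n, h) =
  (if k == (n.+1, i) then npoints n else 0)%:C.
Proof.
case: k => m j iw; have [jw|jw] := boolP (j \in words m); last first.
  rewrite big1 => [|h _]; last by rewrite /xfun (negPf jw) mulr0.
  by case: eqP => // -[mn ji]; rewrite mn ji iw in jw.
rewrite big_seq (eq_bigr (fun h => (hichar R (s n) i h * (if n == m then lochar R (s n) j h
     else if n.+1 == m then hichar R (s n) j h else 0))%:C)); last first.
  by move=> h hp; rewrite /xfun /= jw hp /= [RHS]rmorphM.
rewrite -big_seq -rmorph_sum; congr (_%:C); rewrite xpair_eqE.
have [nm|nm] := eqVneq n m.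
  subst m; rewrite (@ltn_eqF n n.+1)//=; under eq_bigr => h _ do rewrite mulrC.
  by rewrite lohi_orth.
rewrite [n.+1 == m]eq_sym; have [nm'|nm'] := eqVneq m n.+1.
  subst m; rewrite (hichar_orth R (s n) iw jw) eq_sym /npoints.
  by case: eqP => _; rewrite ?mulr1 ?mulr0.
by rewrite big1// => h _; rewrite mulr0.
Qed.

(** The functional dual to [xel n i], written on block [n]. *)
Definition yel n i : alg :=
  ((npoints n)^-1)%:C *: \sum_(h <- points n) (lochar R (s n) i h)%:C *: del n h.

Lemma inspan_match n i x : i \in words n.+1 -> x \in @inspan R xdata ->
  ((npoints n.+1)^-1)%:C * \sum_(h <- points n.+1) (lochar R (s n.+1) i h)%:C * x (n.+1, h) =
  ((npoints n)^-1)%:C * \sum_(h <- points n) (hichar R (s n) i h)%:C * x (n, h).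
Proof.
move=> iw xs; apply/eqP; rewrite -subr_eq0; apply/eqP.
pose r : seq (R[i] * pt xdata) :=
  [seq (((npoints n.+1)^-1)%:C * (lochar R (s n.+1) i h)%:C, (n.+1, h)) | h <- points n.+1] ++
  [seq (- ((npoints n)^-1)%:C * (hichar R (s n) i h)%:C, (n, h)) | h <- points n].
have rE (F : pt xdata -> R[i]) : \sum_(p <- r) p.1 * F p.2 =
   ((npoints n.+1)^-1)%:C * (\sum_(h <- points n.+1) (lochar R (s n.+1) i h)%:C * F (n.+1, h)) -
   ((npoints n)^-1)%:C * (\sum_(h <- points n) (hichar R (s n) i h)%:C * F (n, h)).
  rewrite big_cat !big_map /= -mulNr !mulr_sumr.
  by congr (_ + _); apply: eq_bigr => h _; rewrite mulrA.
rewrite -rE; apply: inspan_annih => // k; rewrite rE lochar_xfun// hichar_xfun//.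
case: eqP => _; rewrite ?mulr0 ?subrr//.
by rewrite -!rmorphM/= !mulVf ?gt_eqF ?npoints_gt0// subrr.
Qed.

Lemma alg_sum (I : Type) (r : seq I) (F : I -> alg) t :
  (\sum_(i <- r) F i) t = \sum_(i <- r) F i t.
Proof. exact: cspan_sum. Qed.

Lemma comb_del n (c : seq letter * bool -> R[i]) (l : seq (seq letter * bool)) t :
  (\sum_(h <- l) c h *: del n h) t =
  match t with inr (inl (x, r)) => if good x r then \sum_(h <- l) c h * x (n, h) else 0
    | _ => 0 end.
Proof.
rewrite alg_sum; under eq_bigr => h _ do rewrite algZ.
case: t => [g|[[x r]|[]]] /=; try by rewrite big1// => h _; rewrite mulr0.
by case: ifP => // _; rewrite big1// => h _; rewrite mulr0.
Qed.

(** The same functional written on the previous block.  The two expressions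
    agree on the functions [xfun] by orthogonality, hence on [X]; this equality,
    which fails for evaluations on arbitrary functions, joins consecutive
    levels. *)
Lemma yel_hi n i : i \in words n.+1 ->
  yel n.+1 i = ((npoints n)^-1)%:C *: \sum_(h <- points n) (hichar R (s n) i h)%:C *: del n h.
Proof.
move=> iw; apply: cspan_eq => t; rewrite /yel !algZ !comb_del.
case: t => [g|[[x r]|[]]] /=; rewrite ?mulr0//.
case: ifP => [/andP[xs _]|]; last by rewrite !mulr0.
exact: inspan_match.
Qed.

Lemma xel_yel n i : i \in words n -> bmul (xel n i) (yel n i) = omega.
Proof.
move=> iw; rewrite /bmul /= /amul.
have -> : pairing (xel n i) (yel n i) = 0 by [].
rewrite add0r /pairing /yel algZ comb_del xpart_good.
have -> : \sum_(h <- points n) (lochar R (s n) i h)%:C * xpart (xel n i) (n, h)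
   = (npoints n)%:C by have := lochar_xfun (n, i) iw; rewrite eqxx.
by rewrite -rmorphM/= mulVf ?gt_eqF ?npoints_gt0// scale1r.
Qed.

(** The coefficients of [del n h] once the mean of [x_i] paired with [y_i] over
    level [n], respectively [n.+1], is written on block [n].  The bit [e] is
    that of the other algebra, to which the [y_i] belong. *)
Definition zlo e n h : alg :=
  ((4 ^+ n)^-1)%:C *: \sum_(i <- words n) (lochar R e i h)%:C *: xel n i.
Definition zhi e n h : alg :=
  ((4 ^+ n.+1)^-1)%:C *: \sum_(j <- words n.+1) (hichar R e j h)%:C *: xel n.+1 j.

Lemma comb_xel n (c : seq letter -> R[i]) (l : seq (seq letter)) t :
  (\sum_(i <- l) c i *: xel n i) t =
  match t with inl g => \sum_(i <- l) c i * xfun (n, i) g | _ => 0 end.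
Proof.
rewrite alg_sum; under eq_bigr => h _ do rewrite algZ.
by case: t => [g|[[x r]|[]]] //=; rewrite big1// => h _; rewrite mulr0.
Qed.

Lemma aver_xfun n m (g : seq letter * bool) (F : seq letter -> R) :
  ((4 ^+ n)^-1)%:C * (\sum_(i <- words n) (F i)%:C * xfun (n, i) (m, g)) =
  (if g \in points m then
     if m == n then aver n (fun i => F i * lochar R (s m) i g)
     else if m.+1 == n then aver n (fun i => F i * hichar R (s m) i g) else 0
   else 0)%:C.
Proof.
case: ifP => gm; last first.
  by rewrite big1 ?mulr0// => i _; rewrite /xfun /= gm andbF mulr0.
rewrite big_seq (eq_bigr (fun i => (F i * (if m == n then lochar R (s m) i g
     else if m.+1 == n then hichar R (s m) i g else 0))%:C)); last first.
  by move=> i iw; rewrite /xfun /= iw gm /= [RHS]rmorphM.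
rewrite -big_seq -rmorph_sum -rmorphM /aver; congr (_%:C).
case: ifP => // _; case: ifP => // _.
by rewrite big1 ?mulr0// => i _; rewrite mulr0.
Qed.

Lemma delta_double n : delta R n <= 2 * delta R n.+1.
Proof.
rewrite /delta; apply: (@le_trans _ _ (2 * (2 ^+ (n %/ 5).+1)^-1)).
  by rewrite exprS invfM mulrA mulfV// mul1r.
rewrite ler_pM2l// lef_pV2 ?posrE ?exprn_gt0// ler_eXn2l ?ltr1n//; lia.
Qed.

(** On block [n] the two means have matching Gram matrices; on the two
    neighbouring blocks only one of them is nonzero, and it is a correlation
    between the two roles of a level. *)
Lemma zdiff e n h : h \in points n -> nr (zlo e n h - zhi e n h) <= 2 * delta R n.
Proof.
move=> hp; have d0 := delta_gt0 R n.
rewrite nr_cspan; apply: cnorm_le => [|t]; first by rewrite mulr_ge0// ltW.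
have -> : (zlo e n h - zhi e n h) t = zlo e n h t - zhi e n h t by [].
rewrite /zlo /zhi !algZ !comb_xel.
case: t => [[m g]|t]; last first.
  rewrite !mulr0 subr0 nr0; apply: mulr_ge0; [by rewrite mulr_ge0// ltW | exact: awt_ge0 (inr t)].
rewrite !aver_xfun /= mulr1 -rmorphB nc_real.
case: ifP => gm; last by rewrite subrr normr0 mulr_ge0// ltW.
have [mn|mn] := eqVneq m n.
  by subst m; rewrite [n == n.+1]ltn_eqF// eqxx; exact: lohi_match.
have [mn'|mn'] := eqVneq m n.+1.
  subst m; rewrite [n.+2 == n]gtn_eqF; last by lia.
  rewrite sub0r normrN.
  have -> : aver n.+1 (fun j => hichar R e j h * lochar R (s n.+1) j g) =
            aver n.+1 (fun j => lochar R (s n.+1) j g * hichar R e j h).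
    by congr (_ * _); apply: eq_bigr => j _; rewrite mulrC.
  by apply: le_trans (lohi_flat _ _ _ gm hp) _; lra.
rewrite eqSS (negPf mn) subr0.
case: eqP => [mn2|]; last by rewrite normr0 mulr_ge0// ltW.
by subst n; apply: le_trans (lohi_flat _ _ _ hp gm) (delta_double _).
Qed.

Lemma zflat e n h : h \in points n -> e != s n -> nr (zlo e n h) <= 2 * delta R n.
Proof.
move=> hp es; have d0 := delta_gt0 R n.
rewrite nr_cspan; apply: cnorm_le => [|t]; first by rewrite mulr_ge0// ltW.
rewrite /zlo algZ comb_xel.
case: t => [[m g]|t]; last first.
  rewrite mulr0 nr0; apply: mulr_ge0; [by rewrite mulr_ge0// ltW | exact: awt_ge0 (inr t)].
rewrite aver_xfun /= mulr1 nc_real.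
case: ifP => gm; last by rewrite normr0 mulr_ge0// ltW.
have [mn|mn] := eqVneq m n.
  by subst m; apply: le_trans (lochar_flat _ hp gm es) _; lra.
case: eqP => [mn2|]; last by rewrite normr0 mulr_ge0// ltW.
by subst n; apply: le_trans (lohi_flat _ _ _ hp gm) (delta_double _).
Qed.

End Algebra.

(** * Two embeddings in the same algebra *)

Section Products.
Variables (R : realType) (B : banachAlgType R[i]).

Lemma nr_bmul (a b : B) : nr (bmul a b) <= nr a * nr b.
Proof. by rewrite -lecR rmorphM /= -!nrE ler_norm_bmul. Qed.

Lemma bmul0l (b : B) : bmul 0 b = 0.
Proof. by rewrite -(scale0r (0 : B)) bmulZl !scale0r. Qed.

Lemma bmul0r (a : B) : bmul a 0 = 0.
Proof. by rewrite -(scale0r (0 : B)) bmulZr !scale0r. Qed.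

Lemma bmul_suml (I : Type) (r : seq I) (F : I -> B) b :
  bmul (\sum_(i <- r) F i) b = \sum_(i <- r) bmul (F i) b.
Proof. by elim: r => [|i r ih]; rewrite ?big_nil ?bmul0l// !big_cons bmulDl ih. Qed.

Lemma bmul_sumr (I : Type) (r : seq I) (F : I -> B) a :
  bmul a (\sum_(i <- r) F i) = \sum_(i <- r) bmul a (F i).
Proof. by elim: r => [|i r ih]; rewrite ?big_nil ?bmul0r// !big_cons bmulDr ih. Qed.

Lemma bmulBr (a b c : B) : bmul a (b - c) = bmul a b - bmul a c.
Proof. by rewrite bmulDr -scaleN1r bmulZr scaleN1r. Qed.

Lemma bmulBl (a b c : B) : bmul (a - b) c = bmul a c - bmul b c.
Proof. by rewrite bmulDl -scaleN1r bmulZl scaleN1r. Qed.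

Lemma nr_sum_size (V : normedModType R[i]) (I : eqType) (r : seq I) (F : I -> V) (M : R) :
  {in r, forall i, nr (F i) <= M} -> nr (\sum_(i <- r) F i) <= (size r)%:R * M.
Proof.
elim: r => [|i r ih] h; first by rewrite big_nil nr0 mul0r.
rewrite big_cons (le_trans (nrD _ _))//= -natr1 mulrDl mul1r addrC lerD//.
  by apply: ih => j jr; apply: h; rewrite inE jr orbT.
by apply: h; rewrite mem_head.
Qed.

Lemma nr_mean (V : normedModType R[i]) (I : eqType) (r : seq I) (F : I -> V) (N M : R) :
  0 < N -> (size r)%:R = N -> {in r, forall i, nr (F i) <= M} ->
  nr ((N^-1)%:C *: \sum_(i <- r) F i) <= M.
Proof.
move=> N0 rN h; rewrite nrZ nc_real ger0_norm ?invr_ge0 ?(ltW N0)//.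
by rewrite ler_pdivrMl// -rN nr_sum_size.
Qed.

Lemma mean_const (V : lmodType R[i]) (I : Type) (r : seq I) (v : V) (N : R) :
  0 < N -> (size r)%:R = N -> (N^-1)%:C *: \sum_(i <- r) v = v.
Proof.
move=> N0 rN; rewrite big_const_seq count_predT iter_addr_0.
rewrite -[v *+ _]scaler_nat scalerA -(rmorph_nat (real_complex R)) rN.
by rewrite -rmorphM /= mulVf ?gt_eqF// scale1r.
Qed.

(** Moves the coefficients of a sum of products from the right factors to the
    left ones. *)
Lemma swap_sums (A A' : lmodType R[i]) (f : {linear A -> B}) (f' : {linear A' -> B})
    (I J : Type) (rI : seq I) (rJ : seq J) (x : I -> A) (d : J -> A')
    (c : I -> J -> R[i]) (a b : R[i]) :
  a *: \sum_(i <- rI) bmul (f (x i)) (f' (b *: \sum_(j <- rJ) c i j *: d j)) =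
  b *: \sum_(j <- rJ) bmul (f (a *: \sum_(i <- rI) c i j *: x i)) (f' (d j)).
Proof.
have -> : \sum_(i <- rI) bmul (f (x i)) (f' (b *: \sum_(j <- rJ) c i j *: d j)) =
    b *: \sum_(j <- rJ) \sum_(i <- rI) c i j *: bmul (f (x i)) (f' (d j)).
  rewrite exchange_big scaler_sumr; apply: eq_bigr => i _.
  rewrite [f' (b *: _)]linearZ [f' (\sum_(_ <- _) _)]linear_sum bmulZr bmul_sumr; congr (_ *: _).
  by apply: eq_bigr => j _; rewrite linearZ bmulZr.
rewrite scalerA mulrC -scalerA scaler_sumr; congr (_ *: _); apply: eq_bigr => j _.
rewrite [f (a *: _)]linearZ [f (\sum_(_ <- _) _)]linear_sum bmulZl bmul_suml; congr (_ *: _).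
by apply: eq_bigr => i _; rewrite linearZ bmulZl.
Qed.

End Products.

Section TwoEmbeddings.
Variables (R : realType) (B : banachAlgType R[i]) (s s' : nat -> bool).
Variables (f : {linear alg R s -> B}) (f' : {linear alg R s' -> B}) (K : R).
Hypothesis K0 : 0 <= K.
Hypothesis fK : forall a, nr (f a) <= K * nr a.
Hypothesis f'K : forall a, nr (f' a) <= K * nr a.

Definition mixed n : B := ((4 ^+ n)^-1)%:C *:
  \sum_(i <- words n) bmul (f (xel R s n i)) (f' (yel R s' n i)).

Lemma mixed_lo n : mixed n = ((npoints R n)^-1)%:C *:
  \sum_(h <- points n) bmul (f (zlo R s (s' n) n h)) (f' (del R s' n h)).
Proof. exact: swap_sums. Qed.

Lemma mixed_hi n : mixed n.+1 = ((npoints R n)^-1)%:C *: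
  \sum_(h <- points n) bmul (f (zhi R s (s' n) n h)) (f' (del R s' n h)).
Proof.
rewrite -swap_sums /mixed big_seq [in RHS]big_seq; congr (_ *: _).
by apply: eq_bigr => i iw; rewrite yel_hi.
Qed.

Lemma points_size n : (size (points n))%:R = npoints R n.
Proof. by rewrite size_points natrM natrX. Qed.

Lemma words_size n : (size (words n))%:R = 4 ^+ n :> R.
Proof. by rewrite size_words natrX. Qed.

Lemma f'_del n h : nr (f' (del R s' n h)) <= K.
Proof. by rewrite (le_trans (f'K _))// ler_piMr// del_norm. Qed.

Lemma mixed_step n : nr (mixed n - mixed n.+1) <= 2 * K ^+ 2 * delta R n.
Proof.
rewrite mixed_lo mixed_hi -scalerBr -sumrB.
apply: nr_mean (npoints_gt0 R n) (points_size n) _ => h hp.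
rewrite -bmulBl -linearB (le_trans (nr_bmul _ _))//.
apply: (@le_trans _ _ (K * (2 * delta R n) * K)); last by lra.
apply: ler_pM; rewrite ?nr_ge0 ?f'_del// (le_trans (fK _))// ler_wpM2l//.
exact: zdiff.
Qed.

Lemma mixed_last n : s n != s' n -> nr (mixed n) <= 2 * K ^+ 2 * delta R n.
Proof.
move=> sn; rewrite mixed_lo.
apply: nr_mean (npoints_gt0 R n) (points_size n) _ => h hp.
rewrite (le_trans (nr_bmul _ _))//.
apply: (@le_trans _ _ (K * (2 * delta R n) * K)); last by lra.
apply: ler_pM; rewrite ?nr_ge0 ?f'_del// (le_trans (fK _))// ler_wpM2l//.
by apply: zflat => //; rewrite eq_sym.
Qed.

(** A closed form of the sum of [delta] from [n] on. *)
Definition tail n : R := delta R n * (10 - n %% 5)%N%:R.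

Lemma tailS n : tail n = tail n.+1 + delta R n.
Proof.
rewrite /tail /delta.
have [n4|n4] := eqVneq (n %% 5)%N 4%N.
  have -> : (n.+1 %/ 5 = (n %/ 5).+1)%N by lia.
  have -> : (n.+1 %% 5 = 0)%N by lia.
  rewrite n4 exprS (_ : 10 - 4 = 6)%N// (_ : 10 - 0 = 10)%N//.
  by field; rewrite expf_neq0.
have -> : (n.+1 %/ 5 = n %/ 5)%N by lia.
have -> : (10 - n %% 5 = (10 - n.+1 %% 5).+1)%N by lia.
by rewrite -(natr1 (10 - n.+1 %% 5)) mulrDr mulr1.
Qed.

Lemma tail_ge n : delta R n <= tail n.
Proof. by rewrite /tail ler_peMr ?(ltW (delta_gt0 _ _))// ler1n; lia. Qed.

Lemma tail_le n : tail n <= 10 * delta R n.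
Proof. by rewrite /tail mulrC ler_wpM2r ?(ltW (delta_gt0 _ _))// ler_nat leq_subr. Qed.

Lemma mixed_small m n : (m <= n)%N -> s n != s' n -> nr (mixed m) <= 2 * K ^+ 2 * tail m.
Proof.
move=> mn sn; have K20 : 0 <= 2 * K ^+ 2 by rewrite mulr_ge0// sqr_ge0.
rewrite -(subKn mn); elim: (n - m)%N (leq_subr m n) => [_|d ih dn].
  by rewrite subn0 (le_trans (mixed_last sn))// ler_wpM2l// tail_ge.
have e : ((n - d.+1).+1 = n - d)%N by lia.
have -> : mixed (n - d.+1) = (mixed (n - d.+1) - mixed (n - d)) + mixed (n - d).
  by rewrite subrK.
rewrite (le_trans (nrD _ _))// tailS e addrC mulrDr lerD//; first by apply: ih; lia.
by rewrite -e mixed_step.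
Qed.

Lemma mixed_close m (th : R) : bmultiplicative f ->
  {in words m, forall i, nr (f (yel R s m i) - f' (yel R s' m i)) <= th} ->
  nr (f (omega R s) - mixed m) <= K * th.
Proof.
move=> fM h.
have -> : f (omega R s) = ((4 ^+ m)^-1)%:C *:
    \sum_(i <- words m) bmul (f (xel R s m i)) (f (yel R s m i)).
  rewrite big_seq (eq_bigr (fun=> f (omega R s))) => [|i iw].
    by rewrite -big_seq mean_const ?exprn_gt0 ?words_size.
  by rewrite -fM xel_yel.
rewrite /mixed -scalerBr -sumrB; apply: nr_mean; [exact: exprn_gt0| exact: words_size |].
move=> i iw; rewrite -bmulBr (le_trans (nr_bmul _ _))//.
apply: ler_pM; rewrite ?nr_ge0//; last exact: h.
by rewrite (le_trans (fK _))// ler_piMr// xel_norm.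
Qed.

Lemma omega_small m n (th : R) : bmultiplicative f -> (m <= n)%N -> s n != s' n ->
  {in words m, forall i, nr (f (yel R s m i) - f' (yel R s' m i)) <= th} ->
  nr (f (omega R s)) <= K * th + 20 * K ^+ 2 * delta R m.
Proof.
move=> fM mn sn h.
have -> : f (omega R s) = (f (omega R s) - mixed m) + mixed m by rewrite subrK.
rewrite (le_trans (nrD _ _))// lerD ?mixed_close//.
rewrite (le_trans (mixed_small mn sn))//.
have := tail_le m; have := sqr_ge0 K; nra.
Qed.

End TwoEmbeddings.

(** * No separable algebra contains them all *)

(** Cantor's diagonal argument. *)
Lemma cantor_collision (C : countType) (c : (nat -> bool) -> C) :
  exists s s', s <> s' /\ c s = c s'.
Proof.
apply: contrapT => H.
have inj s s' : c s = c s' -> s = s'.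
  by move=> e; apply: contrapT => ne; apply: H; exists s, s'.
pose d n := ~~ `[< exists2 s, pickle (c s) = n & s n >].
have := erefl (d (pickle (c d))); rewrite {1}/d.
case: asboolP => [[s /(pcan_inj pickleK)/inj -> dd]|nd]; first by rewrite dd.
by case e: (d _) => // _; apply: nd; exists d.
Qed.

Lemma bounded_op_nat (R : realType) (V W : normedModType R[i]) (f : {linear V -> W}) :
  bounded_op f -> exists K : nat, forall x, nr (f x) <= K%:R * nr x.
Proof.
rewrite /bounded_op => fb.
have ub x : `|x| <= 1 -> ((nr (f x))%:E <= opnorm f)%E.
  by move=> x1; apply: ereal_sup_ubound; exists x.
have f0 : (0 <= opnorm f)%E.
  by have := ub 0; rewrite normr0 linear0 nr0; apply; exact: ler01.
have ffin : opnorm f \is a fin_num by rewrite ge0_fin_numE.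
exists (Num.bound (fine (opnorm f))) => x.
have [->|x0] := eqVneq x 0; first by rewrite linear0 !nr0 mulr0.
have nx : 0 < nr x.
  by rewrite lt_neqAle nr_ge0 andbT eq_sym; apply: contra_neq x0; exact: nr_eq0.
have nE : nc ((nr x)^-1)%:C = (nr x)^-1.
  by rewrite nc_real ger0_norm// invr_ge0 nr_ge0.
have := ub (((nr x)^-1)%:C *: x); rewrite -[1](rmorph1 (real_complex R)) -nr_le.
rewrite linearZ !nrZ nE mulVf ?gt_eqF// lexx => /(_ isT).
rewrite -(fineK ffin) lee_fin ler_pdivrMl// mulrC => /le_trans; apply.
by rewrite ler_wpM2r ?nr_ge0// ltW// archi_boundP// fine_ge0.
Qed.

(** The code of a sequence [s] records a norm bound [K], a lower bound
    [1 / q.+1] for the image of [omega], approximations of the images of the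
    [y_i] of a level [m] that depends on [K] and [q], and the first [m] bits.  Two
    sequences with the same code first differ at some [n >= m]. *)
Theorem no_universal_algebra (R : realType) (B : banachAlgType R[i]) : separable B ->
  ~ forall A : banachAlgType R[i], separable A -> bcommutative A ->
    exists f : {linear A -> B}, hom_embedding f /\ bounded_op f.
Proof.
move=> [D Dc Dd] H.
have emb s : {f : {linear alg R s -> B} | bmultiplicative f /\ injective f &
    exists K : nat, forall x, nr (f x) <= K%:R * nr x}.
  apply: cid2; have [f [[fM fI _ _] fb]] := H _ (@alg_separable R s) (@alg_commutative R s).
  by exists f; [split | exact: bounded_op_nat].
pose f s : {linear alg R s -> B} := s2val (emb s).
have fM s : bmultiplicative (f s) by case: (s2valP (emb s)).
have fI s : injective (f s) by case: (s2valP (emb s)).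
have /choice[K fK] : forall s, exists K : nat, forall x, nr (f s x) <= K%:R * nr x.
  by move=> s; exact: s2valP' (emb s).
have fomega s : 0 < nr (f s (omega R s)).
  rewrite lt_neqAle nr_ge0 andbT eq_sym; apply/eqP => /nr_eq0 e.
  by apply: (@omega_neq0 R s); apply: (fI s); rewrite e linear0.
have /choice[q fq] : forall s, exists q : nat, q.+1%:R^-1 < nr (f s (omega R s)).
  move=> s; exists (Num.bound (nr (f s (omega R s)))^-1).
  rewrite invf_plt ?posrE//; apply: lt_trans (archi_boundP _) _.
    by rewrite invr_ge0 nr_ge0.
  by rewrite ltr_nat.
(* Level [m = 5 * p], where [delta] is at most [1 / p], and precision [th] are
   chosen so that both terms of [omega_small] are at most [1 / (2 * q.+1)]. *)
pose p (k l : nat) := (40 * k.+1 ^ 2 * l.+1)%N.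
pose m k l := (5 * p k l)%N.
pose th (k l : nat) : R := (4 * k.+1%:R * l.+1%:R)^-1.
have th0 k l : 0 < th k l by rewrite invr_gt0 !mulr_gt0.
have /choice[a fa] : forall z : (nat -> bool) * seq letter, exists b, D b /\
    nr (f z.1 (yel R z.1 (m (K z.1) (q z.1)) z.2) - b) < th (K z.1) (q z.1).
  move=> [s i] /=; set y := f s _; set e := th _ _.
  have e0 : 0 < e%:C by rewrite ltcR; exact: th0.
  have [||b [yb Db]] := Dd (ball y e%:C); [by exists y; exact: ballxx|exact: ball_open|].
  by exists b; split=> //; move: yb; rewrite -ball_normE/= -nr_lt.
have /countable_injP[num numI] := Dc.
pose code s := (K s, q s, [seq num (a (s, i)) | i <- words (m (K s) (q s))],
                 [seq s n | n <- iota 0 (m (K s) (q s))]).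
have [s [s' [neq ecode]]] := cantor_collision code.
have eK : K s = K s' := congr1 (fun z => z.1.1.1) ecode.
have eq_q : q s = q s' := congr1 (fun z => z.1.1.2) ecode.
have enum : {in words (m (K s) (q s)), forall i, num (a (s, i)) = num (a (s', i))}.
  by apply/eq_in_map; rewrite [in RHS]eK [in RHS]eq_q; exact (congr1 (fun z => z.1.2) ecode).
have ebits : {in iota 0 (m (K s) (q s)), s =1 s'}.
  by apply/eq_in_map; rewrite [in RHS]eK [in RHS]eq_q; exact (congr1 (fun z => z.2) ecode).
have [n sn] : exists n, s n != s' n.
  apply: contrapT => h; apply: neq; apply/funext => n; apply/eqP/negPn/negP => e.
  by apply: h; exists n.
set k := K s in eK enum ebits *; set l := q s in eq_q enum ebits *.
have mn : (m k l <= n)%N.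
  rewrite leqNgt; apply/negP => nm; case/negP: sn; apply/eqP/ebits.
  by rewrite mem_iota.
have fK' x : nr (f s' x) <= k%:R * nr x by rewrite eK.
have := @omega_small R B s s' (f s) (f s') k%:R (ler0n _ _) (fK s) fK' (m k l) n
   (2 * th k l) (fM s) mn sn.
have near i : i \in words (m k l) ->
    nr (f s (yel R s (m k l) i) - f s' (yel R s' (m k l) i)) <= 2 * th k l.
  move=> iw; have [Ds hs] := fa (s, i); have [Ds' hs'] := fa (s', i).
  have e : a (s, i) = a (s', i) by apply: numI; rewrite ?inE// enum.
  move: hs hs'; rewrite /= -eK -eq_q -/k -/l e => hs hs'.
  apply: le_trans (nr_sub _ (a (s', i)) _) _; rewrite (nrC (a _)).
  by move: hs hs'; lra.
move=> /(_ near); apply/negP; rewrite -ltNge; apply: le_lt_trans (fq s).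
rewrite -/l /delta /m mulKn//.
have pk : (p k l)%:R <= 2 ^+ p k l :> R by rewrite -natrX ler_nat ltnW// ltn_expl.
have p0 : 0 < (p k l)%:R :> R by rewrite ltr0n.
apply: (@le_trans _ _ (k.+1%:R * (2 * th k l) + 20 * k.+1%:R ^+ 2 * (p k l)%:R^-1)).
  apply: lerD; first by rewrite ler_wpM2r ?ler_nat// mulr_ge0// ltW.
  apply: ler_pM; rewrite ?mulr_ge0 ?invr_ge0 ?exprn_ge0//.
    by rewrite ler_wpM2l// lerXn2r ?nnegrE// ler_nat.
  by rewrite lef_pV2 ?posrE ?exprn_gt0.
rewrite /th /p !natrM le_eqVlt; apply/orP; left; apply/eqP.
have : l.+1%:R != 0 :> R by rewrite pnatr_eq0.
have : k.+1%:R != 0 :> R by rewrite pnatr_eq0.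
move: (k.+1%:R : R) (l.+1%:R : R) => k' l' k'0 l'0.
by field; rewrite k'0 l'0.
Qed.

Theorem theorem1p1 (R : realType) :
  [/\ ~ (exists B : banachAlgType R[i],
          [/\ separable B, bcommutative B &
            forall A : banachAlgType R[i], separable A -> bcommutative A ->
              exists f : {linear A -> B}, hom_embedding f /\ contractive f]),
      ~ (exists B : banachAlgType R[i],
          [/\ separable B, bcommutative B &
            forall A : banachAlgType R[i], separable A -> bcommutative A ->
              exists f : {linear A -> B}, hom_embedding f /\ bounded_op f]),
      ~ (exists B : banachAlgType R[i],
          separable B /\
            forall A : banachAlgType R[i], separable A ->
              exists f : {linear A -> B}, hom_embedding f /\ contractive f) &
      ~ (exists B : banachAlgType R[i],
          separable B /\
            forall A : banachAlgType R[i], separable A ->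
              exists f : {linear A -> B}, hom_embedding f /\ bounded_op f)].
Proof.
have contr (A B : banachAlgType R[i]) (f : {linear A -> B}) : contractive f -> bounded_op f.
  by move=> /le_lt_trans; apply; exact: ltry.
split=> [] [B].
- move=> [Bsep _ H]; apply: (no_universal_algebra Bsep) => A As Ac.
  by have [f [fe /contr fb]] := H A As Ac; exists f.
- by move=> [Bsep _ H]; exact: (no_universal_algebra Bsep).
- move=> [Bsep H]; apply: (no_universal_algebra Bsep) => A As _.
  by have [f [fe /contr fb]] := H A As; exists f.
- move=> [Bsep H]; apply: (no_universal_algebra Bsep) => A As _.
  exact: H A As.
Qed.
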